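(* Let $N$ be a positive integer, $a(k)\in\mathbb{H}$ and $b(k)\in\mathbb{H}\setminus\{0\}$ for $0\le k\le N$, and $h_1,h_2\in\mathbb{H}$. Let $\mathcal{L}$ (with matrix $L$) be the associated difference operator and $\boldsymbol{\varphi}(\lambda,s)$ the associated solution vector, as defined in the context. Suppose that $\mathcal{L}$ (equivalently $L$) is normal. Then for any fixed $s\in\mathbb{H}\setminus\{0\}$, there exist $N$ distinct quaternions $\lambda_1,\lambda_2,\dots,\lambda_N$ such that 1. $V=\{\boldsymbol{\varphi}(\lambda_1,s),\boldsymbol{\varphi}(\lambda_2,s),\dots,\boldsymbol{\varphi}(\lambda_N,s)\}$ is an orthogonal basis of $\mathbb{H}^N$; 2. every element of $V$ is a solution of the boundary value problem $(E)$, $(B_1)$, $(B_2)$ (that is, $\boldsymbol{\varphi}(\lambda_k,s)$ is a solution with parameter $\lambda=\lambda_k$), and therefore $\lambda_k$ is a right eigenvalue of $L$ for $k=1,2,\dots,N$.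
   Context: $\mathbb{H}$ is the skew field of real quaternions. $\mathbb{H}^N$ is regarded as a right $\mathbb{H}$-module with inner product $\langle\boldsymbol{\xi},\boldsymbol{\eta}\rangle=\boldsymbol{\xi}^*\boldsymbol{\eta}=\sum_k\overline{\xi_k}\eta_k$; orthogonality and basis (over right scalars) are meant in this sense. Consider the difference equation $$(E)\quad b(k)x(k+1)+a(k)x(k)+b(k-1)x(k-1)=x(k)\lambda,\quad k=1,2,\dots,N,$$ with parameter $\lambda\in\mathbb{H}$, and the boundary conditions $$(B_1)\quad x(0)+h_1x(1)=0,\qquad (B_2)\quad x(N+1)+h_2x(N)=0.$$ A vector $[x(1),\dots,x(N)]^\top$ is called a solution of $(E)$, $(B_1)$, $(B_2)$ if, with $x(0)$ and $x(N+1)$ determined by $(B_1)$ and $(B_2)$, equation $(E)$ holds. The right $\mathbb{H}$-linear operator $\mathcal{L}$ on $\mathbb{H}^N$ is defined for $\boldsymbol{x}=[x(1),\dots,x(N)]^\top$ by $(\mathcal{L}\boldsymbol{x})(k)=b(k)x(k+1)+a(k)x(k)+b(k-1)x(k-1)$, $1\le k\le N$, where $x(0):=-h_1x(1)$ and $x(N+1):=-h_2x(N)$. $L\in M_N(\mathbb{H})$ is its matrix ($\mathcal{L}\boldsymbol{x}=L\boldsymbol{x}$): the symmetric tridiagonal matrix with diagonal $a(1)-b(0)h_1,\ a(2),\dots,a(N-1),\ a(N)-b(N)h_2$ and off-diagonal entries $b(1),\dots,b(N-1)$. Normal means $LL^*=L^*L$ with $L^*$ the conjugate transpose. A right eigenvalue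 of $L$ is $\lambda\in\mathbb{H}$ with $L\boldsymbol{\xi}=\boldsymbol{\xi}\lambda$ for some $\boldsymbol{\xi}\ne 0$. For $\lambda,s\in\mathbb{H}$, $\phi(k,\lambda,s)$ ($0\le k\le N+1$) denotes the unique solution $x(k)$ of $(E)$ and $(B_1)$ with $x(1)=s$, and $\boldsymbol{\varphi}(\lambda,s)=[\phi(1,\lambda,s),\dots,\phi(N,\lambda,s)]^\top$. *)

(* Defs.v *)
From HB Require Import structures.
From mathcomp Require Import all_boot all_order all_algebra.
From mathcomp Require Import ring.
From mathcomp Require Import reals.

Set Implicit Arguments.
Unset Strict Implicit.
Unset Printing Implicit Defensive.

Import Order.TTheory GRing.Theory Num.Theory.
Local Open Scope ring_scope.

(* Quat p q r s is p + q i + r j + s k. *)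
Record quat (R : Type) : Type := Quat { qre : R; qi : R; qj : R; qk : R }.

Section QuatChoice.
Variable R : choiceType.

Definition quat_to_prod (x : quat R) : R * R * R * R :=
  (qre x, qi x, qj x, qk x).
Definition quat_of_prod (t : R * R * R * R) : quat R :=
  Quat t.1.1.1 t.1.1.2 t.1.2 t.2.

Lemma quat_to_prodK : cancel quat_to_prod quat_of_prod.
Proof. by case. Qed.

HB.instance Definition _ := Choice.copy (quat R) (can_type quat_to_prodK).
End QuatChoice.

Section QuatRing.
Variable R : realFieldType.
Implicit Types x y z : quat R.

Definition quat_zero : quat R := Quat 0 0 0 0.
Definition quat_one : quat R := Quat 1 0 0 0.
Definition quat_opp x : quat R := Quat (- qre x) (- qi x) (- qj x) (- qk x).
Definition quat_add x y : quat R :=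
  Quat (qre x + qre y) (qi x + qi y) (qj x + qj y) (qk x + qk y).

(* i^2 = j^2 = k^2 = -1, i j = k = - j i, j k = i = - k j, k i = j = - i k *)
Definition quat_mul x y : quat R :=
  Quat (qre x * qre y - qi x * qi y - qj x * qj y - qk x * qk y)
       (qre x * qi y + qi x * qre y + qj x * qk y - qk x * qj y)
       (qre x * qj y - qi x * qk y + qj x * qre y + qk x * qi y)
       (qre x * qk y + qi x * qj y - qj x * qi y + qk x * qre y).

Definition conjq x : quat R := Quat (qre x) (- qi x) (- qj x) (- qk x).

Definition normsq x : R := qre x ^+ 2 + qi x ^+ 2 + qj x ^+ 2 + qk x ^+ 2.

Definition quat_inv x : quat R :=
  Quat (qre x / normsq x) (- qi x / normsq x)
       (- qj x / normsq x) (- qk x / normsq x).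

Lemma quat_addA : associative quat_add.
Proof. by move=> x y z; rewrite /quat_add /= !addrA. Qed.

Lemma quat_addC : commutative quat_add.
Proof. by move=> x y; congr Quat; apply: addrC. Qed.

Lemma quat_add0 : left_id quat_zero quat_add.
Proof. by case=> p q r s; rewrite /quat_add /= !add0r. Qed.

Lemma quat_addN : left_inverse quat_zero quat_opp quat_add.
Proof. by case=> p q r s; rewrite /quat_add /= !addNr. Qed.

HB.instance Definition _ :=
  GRing.isZmodule.Build (quat R) quat_addA quat_addC quat_add0 quat_addN.

Lemma quat_mulA : associative quat_mul.
Proof. by move=> x y z; rewrite /quat_mul /=; congr Quat; ring. Qed.

Lemma quat_mul1l : left_id quat_one quat_mul.
Proof. by case=> p q r s; rewrite /quat_mul /=; congr Quat; ring. Qed.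

Lemma quat_mul1r : right_id quat_one quat_mul.
Proof. by case=> p q r s; rewrite /quat_mul /=; congr Quat; ring. Qed.

Lemma quat_mulDl : left_distributive quat_mul quat_add.
Proof. by move=> x y z; rewrite /quat_mul /quat_add /=; congr Quat; ring. Qed.

Lemma quat_mulDr : right_distributive quat_mul quat_add.
Proof. by move=> x y z; rewrite /quat_mul /quat_add /=; congr Quat; ring. Qed.

Lemma quat_1_neq0 : quat_one != 0.
Proof. by apply/eqP => -[] /eqP; rewrite oner_eq0. Qed.

HB.instance Definition _ := GRing.Zmodule_isNzRing.Build (quat R)
  quat_mulA quat_mul1l quat_mul1r quat_mulDl quat_mulDr quat_1_neq0.

Lemma normsq_eq0 x : (normsq x == 0) = (x == 0).
Proof.
case: x => p q r s; rewrite /normsq /= !paddr_eq0 ?addr_ge0 ?sqr_ge0 //.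
rewrite !sqrf_eq0; apply/idP/eqP.
  by case/andP => /andP[/andP[/eqP-> /eqP->] /eqP->] /eqP->.
by case=> -> -> -> ->; rewrite !eqxx.
Qed.

Definition quat_unit : pred (quat R) := [pred x | x != 0].

Lemma quat_mulVr : {in quat_unit, left_inverse 1 quat_inv *%R}.
Proof.
move=> x; rewrite inE -normsq_eq0 => nx0.
by congr Quat; rewrite /quat_inv /=; move: nx0; rewrite /normsq => nx0; field.
Qed.

Lemma quat_mulrV : {in quat_unit, right_inverse 1 quat_inv *%R}.
Proof.
move=> x; rewrite inE -normsq_eq0 => nx0.
by congr Quat; rewrite /quat_inv /=; move: nx0; rewrite /normsq => nx0; field.
Qed.

Lemma quat_unitP x y : y * x = 1 /\ x * y = 1 -> quat_unit x.
Proof.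
case=> yx1 _; rewrite /quat_unit /=; apply/eqP => x0.
by move: yx1; rewrite x0 mulr0 => /esym/eqP; rewrite oner_eq0.
Qed.

Lemma quat_inv_out : {in [predC quat_unit], quat_inv =1 id}.
Proof.
move=> x; rewrite inE /= negbK => /eqP ->.
by rewrite /quat_inv /= oppr0 !mul0r.
Qed.

HB.instance Definition _ := GRing.NzRing_hasMulInverse.Build (quat R)
  quat_mulVr quat_mulrV quat_unitP quat_inv_out.

Lemma quat_unitE x : (x \is a GRing.unit) = (x != 0).
Proof. by []. Qed.

End QuatRing.

Section RightModule.
Variables (R : realFieldType) (N : nat).
Local Notation H := (quat R).

(* MathComp's *: is the left action, hence a separate right action. *)
Definition rscale (v : 'cV[H]_N) (c : H) : 'cV[H]_N := \col_i (v i 0 * c).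

Definition adjmx (m n : nat) (A : 'M[H]_(m, n)) : 'M[H]_(n, m) :=
  (map_mx (@conjq R) A)^T.

Definition innerq (v w : 'cV[H]_N) : H := \sum_k conjq (v k 0) * w k 0.

Definition is_normal (A : 'M[H]_N) : Prop := A *m adjmx A = adjmx A *m A.

Definition right_eigenvalue (A : 'M[H]_N) (lam : H) : Prop :=
  exists2 xi : 'cV[H]_N, xi != 0 & A *m xi = rscale xi lam.

Definition right_free (n : nat) (f : 'I_n -> 'cV[H]_N) : Prop :=
  forall c : 'I_n -> H,
    \sum_k rscale (f k) (c k) = 0 -> forall k, c k = 0.

Definition right_spanning (n : nat) (f : 'I_n -> 'cV[H]_N) : Prop :=
  forall v : 'cV[H]_N,
    exists c : 'I_n -> H, v = \sum_k rscale (f k) (c k).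

Definition right_basis (n : nat) (f : 'I_n -> 'cV[H]_N) : Prop :=
  right_free f /\ right_spanning f.

Definition orthogonal_family (n : nat) (f : 'I_n -> 'cV[H]_N) : Prop :=
  forall i j : 'I_n, i != j -> innerq (f i) (f j) = 0.

Definition orthogonal_basis (n : nat) (f : 'I_n -> 'cV[H]_N) : Prop :=
  orthogonal_family f /\ right_basis f.

Lemma innerqE (v w : 'cV[H]_N) : innerq v w = (adjmx v *m w) 0 0.
Proof. by rewrite mxE; apply: eq_bigr => k _; rewrite !mxE. Qed.

End RightModule.

Section DifferenceEquation.
Variables (R : realFieldType) (N : nat).
Local Notation H := (quat R).
(* Only the values at 0, ..., N of a and b, and at 0, ..., N+1 of a sequence x,
   are relevant. *)
Variables (a b : nat -> H) (h1 h2 : H).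

Definition diff_expr (x : nat -> H) (k : nat) : H :=
  b k * x k.+1 + a k * x k + b k.-1 * x k.-1.

Definition diff_eqn (lam : H) (x : nat -> H) : Prop :=
  forall k, (1 <= k <= N)%N -> diff_expr x k = x k * lam.

Definition left_bc (x : nat -> H) : Prop := x 0%N + h1 * x 1%N = 0.

Definition right_bc (x : nat -> H) : Prop := x N.+1 + h2 * x N = 0.

(* The entry of index i : 'I_N of a column is the value x(i+1). *)
Definition col_val (v : 'cV[H]_N) (k : nat) : H :=
  if insub k.-1 is Some i then v i 0 else 0.

Definition bc_extend (v : 'cV[H]_N) (k : nat) : H :=
  if k == 0%N then - (h1 * col_val v 1)
  else if k == N.+1 then - (h2 * col_val v N)
  else col_val v k.

Definition bvp_solution (lam : H) (v : 'cV[H]_N) : Prop :=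
  diff_eqn lam (bc_extend v).

Definition diff_op (v : 'cV[H]_N) : 'cV[H]_N :=
  \col_(i < N) diff_expr (bc_extend v) i.+1.

(* For N = 1 both boundary terms fall on the single diagonal entry. *)
Definition diff_mx : 'M[H]_N := \matrix_(i < N, j < N)
  if i == j then
    a i.+1 - (if i == 0%N :> nat then b 0%N * h1 else 0)
           - (if i.+1 == N then b N * h2 else 0)
  else if j == i.+1 :> nat then b i.+1
  else if i == j.+1 :> nat then b j.+1
  else 0.

(* phi_pair k = (x(k), x(k+1)) where x solves diff_eqn and left_bc with x(1) = s:
   diff_eqn at k+1 is solved for x(k+2). *)
Fixpoint phi_pair (lam s : H) (k : nat) : H * H :=
  if k is k'.+1 then
    let: (x0, x1) := phi_pair lam s k' in
    (x1, (b k)^-1 * (x1 * lam - a k * x1 - b k' * x0))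
  else (- (h1 * s), s).

Definition phi (k : nat) (lam s : H) : H := (phi_pair lam s k).1.

Definition varphi (lam s : H) : 'cV[H]_N := \col_(i < N) phi i.+1 lam s.

Lemma phi0 lam s : phi 0 lam s = - (h1 * s).
Proof. by []. Qed.

Lemma phi1 lam s : phi 1 lam s = s.
Proof. by []. Qed.

Lemma phiSS lam s k : phi k.+2 lam s =
  (b k.+1)^-1 * (phi k.+1 lam s * lam - a k.+1 * phi k.+1 lam s
                 - b k * phi k lam s).
Proof. by rewrite /phi /=; case: (phi_pair lam s k). Qed.

Lemma left_bcE (x : nat -> H) : left_bc x <-> x 0%N = - (h1 * x 1%N).
Proof.
rewrite /left_bc; split=> [/eqP|->]; last by rewrite addNr.
by rewrite addr_eq0 => /eqP.
Qed.

Lemma phi_unique_solution (lam s : H) (x : nat -> H) :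
    (forall k, (k <= N)%N -> b k != 0) ->
  [/\ diff_eqn lam x, left_bc x & x 1%N = s] <->
  (forall k, (k <= N.+1)%N -> x k = phi k lam s).
Proof.
move=> b0; split=> [[hE /left_bcE hB hs] k|hx].
  suff: ((k <= N.+1)%N -> x k = phi k lam s)
        /\ ((k.+1 <= N.+1)%N -> x k.+1 = phi k.+1 lam s) by case.
  elim: k => [|k [IH0 IH1]]; first by rewrite hB hs.
  split=> // kN; rewrite phiSS -IH1 ?(ltnW kN) // -IH0; last first.
    by rewrite ltnW // ltnW.
  have := hE k.+1; rewrite /diff_expr /= => <-; last by rewrite -ltnS.
  by rewrite addrAC addrK addrK mulKr // quat_unitE b0.
split; last by rewrite hx.
  move=> [//|k] /= kN; rewrite /diff_expr /= !hx; first last.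
  - by rewrite ltnS.
  - by rewrite ltnW.
  - by rewrite ltnW // ltnW.
  rewrite phiSS mulVKr ?quat_unitE ?b0 //.
  by rewrite addrAC subrK subrK.
by apply/left_bcE; rewrite !hx.
Qed.

Lemma bc_extend_val (v : 'cV[H]_N) (i : 'I_N) : bc_extend v i.+1 = v i 0.
Proof. by rewrite /bc_extend /= eqSS ltn_eqF ?ltn_ord // /col_val /= valK. Qed.

Lemma bvp_solutionP (lam : H) (v : 'cV[H]_N) : (0 < N)%N ->
  bvp_solution lam v <->
  exists x : nat -> H, [/\ forall i : 'I_N, x i.+1 = v i 0,
                           left_bc x, right_bc x & diff_eqn lam x].
Proof.
move=> N0; have ext1 : bc_extend v 1 = col_val v 1.
  by rewrite /bc_extend /= eqSS ltn_eqF.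
have extN : bc_extend v N = col_val v N.
  by rewrite /bc_extend gtn_eqF // ltn_eqF.
split=> [hv|[x [hx /left_bcE h1x hB2 hE]] k kN].
  exists (bc_extend v); split=> //; first exact: bc_extend_val.
    by apply/left_bcE; rewrite ext1.
  by rewrite /right_bc extN /bc_extend /= eqxx addNr.
have xk j : (1 <= j <= N)%N -> x j = col_val v j.
  case: j => // j jN; rewrite /col_val /= insubT.
  by rewrite -hx.
have xe j : (j <= N.+1)%N -> bc_extend v j = x j.
  move=> jN; rewrite /bc_extend; case: eqVneq => [->|j0].
    by rewrite h1x xk // N0.
  case: eqVneq => [->|jN1].
    by rewrite -xk ?N0 ?leqnn //; apply/esym/eqP; rewrite -addr_eq0; apply/eqP.
  by rewrite xk // lt0n j0 -ltnS ltn_neqAle jN1.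
have := hE k kN; case/andP: kN => k1 kN.
by rewrite /diff_expr !xe // ltnW // ltnS // (leq_trans (leq_pred _)).
Qed.

Lemma diff_opE (v : 'cV[H]_N) : diff_op v = diff_mx *m v.
Proof.
have cvS j : col_val v j.+1 = \sum_(i < N | i == j :> nat) v i 0.
  rewrite /col_val /=; case: insubP => [i _ ij|jN].
    by rewrite (big_pred1 i) // => l; rewrite -ij.
  rewrite big_pred0 // => l; apply/eqP => lj.
  by rewrite -lj ltn_ord in jN.
apply/colP => i; rewrite [LHS]mxE [RHS]mxE /diff_expr bc_extend_val.
have -> : b i.+1 * bc_extend v i.+2 = 
   \sum_(j < N) (if j == i.+1 :> nat then b i.+1 * v j 0 else 0)
   - (if i.+1 == N then b N * h2 else 0) * v i 0.
  rewrite -big_mkcond -big_distrr /= -cvS {1}/bc_extend /= eqSS.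
  case: eqP => [iN|_]; last by rewrite mul0r subr0.
  have -> : col_val v i.+2 = 0 by rewrite /col_val /= insubF // iN ltnn.
  have cvN : col_val v i.+1 = v i 0 by rewrite /col_val /= valK.
  rewrite iN in cvN; rewrite cvN.
  by rewrite iN mulr0 sub0r mulrN mulrA.
have -> : b i * bc_extend v i =
   \sum_(j < N) (if i == j.+1 :> nat then b j.+1 * v j 0 else 0)
   - (if i == 0%N :> nat then b 0%N * h1 else 0) * v i 0.
  case: i => [[|i] Hi] /=.
    rewrite big1 // sub0r /bc_extend /= mulrN mulrA; congr (- (_ * _)).
    by rewrite /col_val /= insubT.
  rewrite mul0r subr0 /bc_extend /= eqSS ltn_eqF; last exact: ltnW.
  rewrite cvS big_distrr /= big_mkcond; apply: eq_bigr => j _.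
  by rewrite eqSS eq_sym; case: eqP => // ->.
set S1 := \sum_(j < N) _; set S2 := \sum_(j < N) _.
pose S3 := \sum_(j < N) (if i == j then diff_mx i i * v i 0 else 0).
have S3E : S3 = diff_mx i i * v i 0.
  by rewrite /S3 (bigD1 i) //= eqxx big1 ?addr0 // => j; rewrite eq_sym; case: eqP.
transitivity (S1 + S2 + S3).
  rewrite S3E mxE eqxx !mulrBl.
  by rewrite addrACA [S1 - _ + _]addrAC [RHS]addrA [LHS]addrAC.
rewrite -!big_split; apply: eq_bigr => j _; rewrite [in RHS]mxE /=.
case: (eqVneq i j) => [<-|ij].
  by rewrite ltn_eqF // !add0r mxE eqxx.
case: (eqVneq (j : nat) i.+1) => [ji|_].
  by rewrite ji ltn_eqF ?addr0 ?ltnS ?leqnSn ?ltnW //.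
by case: eqP => _; rewrite ?mul0r ?add0r ?addr0.
Qed.

End DifferenceEquation.

(* Main.v *)
Require Import Defs.
From HB Require Import structures.
From mathcomp Require Import all_boot all_order all_algebra.
From mathcomp Require Import ring.
From mathcomp Require Import reals complex.

Set Implicit Arguments.
Unset Strict Implicit.
Unset Printing Implicit Defensive.

Import Order.TTheory GRing.Theory Num.Theory.
Local Open Scope ring_scope.

(* A normal quaternionic matrix A has an orthogonal basis of right eigenvectors,
   built one vector at a time: if A v = v lam then A^* v = v conj(lam), so the
   orthogonal complement of the eigenvectors found so far is A-stable.  A nonzero
   u in it is annihilated by a nonzero polynomial in A, the vectors A^k u being
   dependent over the reals; splitting this polynomial over R[i], acting on the
   right, yields an eigenvector in the complement.  For the difference operator
   an eigenvector v is determined by its eigenvalue and its first entry v(1),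
   which is thus nonzero; so v may be scaled on the right by v(1)^-1 s, which
   conjugates its eigenvalue and turns it into varphi(lam, s).  Equal eigenvalues
   would then give equal, hence non-orthogonal, vectors. *)

(** * Quaternionic matrices, adjoints and linear dependence *)

Section QuaternionMatrices.
Variable R : realFieldType.
Local Notation H := (quat R).
Implicit Types x y : H.

Definition realq (r : R) : H := Quat r 0 0 0.

Lemma quatD x y :
  x + y = Quat (qre x + qre y) (qi x + qi y) (qj x + qj y) (qk x + qk y).
Proof. by []. Qed.

Lemma quatN x : - x = Quat (- qre x) (- qi x) (- qj x) (- qk x).
Proof. by []. Qed.

Lemma quatM x y : x * y =
  Quat (qre x * qre y - qi x * qi y - qj x * qj y - qk x * qk y)
       (qre x * qi y + qi x * qre y + qj x * qk y - qk x * qj y)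
       (qre x * qj y - qi x * qk y + qj x * qre y + qk x * qi y)
       (qre x * qk y + qi x * qj y - qj x * qi y + qk x * qre y).
Proof. by []. Qed.

Lemma quat0 : 0 = Quat 0 0 0 0 :> H. Proof. by []. Qed.

Lemma conjqK : involutive (@conjq R).
Proof. by case=> p q r s; rewrite /conjq /= !opprK. Qed.

Lemma conjqD x y : conjq (x + y) = conjq x + conjq y.
Proof. by rewrite !quatD /conjq /=; congr Quat; ring. Qed.

Lemma conjqM x y : conjq (x * y) = conjq y * conjq x.
Proof. by rewrite !quatM /conjq /=; congr Quat; ring. Qed.

Lemma conjq0 : conjq (0 : H) = 0.
Proof. by rewrite quat0 /conjq /= oppr0. Qed.

Lemma mul_conjq x : conjq x * x = realq (normsq x).
Proof. by rewrite quatM /realq /normsq /conjq /=; congr Quat; ring. Qed.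

Lemma mulq_conj x : x * conjq x = conjq x * x.
Proof. by rewrite !quatM /conjq /=; congr Quat; ring. Qed.

Lemma realq_comm r x : realq r * x = x * realq r.
Proof. by rewrite !quatM /=; congr Quat; ring. Qed.

Lemma realqD : {morph realq : r s / r + s}.
Proof. by move=> r s; rewrite quatD /realq /= !addr0. Qed.

Lemma normsq_ge0 x : 0 <= normsq x.
Proof. by rewrite !addr_ge0 ?sqr_ge0. Qed.

Lemma quat_mulf_eq0 x y : (x * y == 0) = (x == 0) || (y == 0).
Proof.
have [->|x0] := eqVneq x 0; first by rewrite mul0r eqxx.
by rewrite (can2_eq (mulKr _) (mulVKr _)) ?quat_unitE // mulr0.
Qed.

Section Adjoint.
Variables m n p : nat.
Implicit Type A : 'M[H]_(m, n).

Lemma adjmxK A : adjmx (adjmx A) = A.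
Proof. by apply/matrixP => i j; rewrite !mxE conjqK. Qed.

Lemma adjmxB A B : adjmx (A - B) = adjmx A - adjmx B.
Proof.
by apply/matrixP => i j; rewrite !mxE conjqD.
Qed.

Lemma adjmxM A (B : 'M[H]_(n, p)) : adjmx (A *m B) = adjmx B *m adjmx A.
Proof.
apply/matrixP => i j; rewrite !mxE (big_morph _ conjqD conjq0).
by apply: eq_bigr => k _; rewrite !mxE conjqM.
Qed.

End Adjoint.

Lemma adjmx_scalar n x : adjmx (x%:M : 'M_n) = (conjq x)%:M.
Proof.
by apply/matrixP => i j; rewrite !mxE eq_sym; case: eqP => // _; rewrite conjq0.
Qed.

(** As a product with a 1 x 1 matrix, right scaling falls under the associativity of matrix
    multiplication. *)
Lemma rscaleE n (v : 'cV[H]_n) x : rscale v x = v *m x%:M.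
Proof. by apply/colP => i; rewrite !mxE big_ord1 !mxE eqxx. Qed.

Section Columns.
Variable N : nat.
Implicit Types u v w : 'cV[H]_N.

Lemma rscaleA v x y : rscale (rscale v x) y = rscale v (x * y).
Proof. by apply/colP => i; rewrite !mxE mulrA. Qed.

Lemma rscale_eq0 v x : (rscale v x == 0) = (v == 0) || (x == 0).
Proof.
have [->|x0] := eqVneq x 0.
  by rewrite orbT; apply/eqP/colP => i; rewrite !mxE mulr0.
rewrite orbF; apply/eqP/eqP => [/colP h|->].
  apply/colP => i; have /eqP := h i; rewrite !mxE quat_mulf_eq0 (negPf x0) orbF.
  by move/eqP.
by apply/colP => i; rewrite !mxE mul0r.
Qed.

Lemma mulmx_rscale m (A : 'M[H]_(m, N)) v x :
  A *m rscale v x = rscale (A *m v) x.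
Proof. by rewrite !rscaleE mulmxA. Qed.

Lemma innerq_eq0 v w : (innerq v w == 0) = (adjmx v *m w == 0).
Proof.
rewrite innerqE; apply/eqP/eqP => [h|->]; last by rewrite mxE.
by apply/matrixP => i j; rewrite !ord1 h mxE.
Qed.

Lemma innerq_conj v w : conjq (innerq v w) = innerq w v.
Proof.
rewrite /innerq (big_morph _ conjqD conjq0).
by apply: eq_bigr => k _; rewrite conjqM conjqK.
Qed.

Lemma innerq_sumr n v (f : 'I_n -> 'cV[H]_N) (c : 'I_n -> H) :
  innerq v (\sum_k rscale (f k) (c k)) = \sum_k innerq v (f k) * c k.
Proof.
rewrite innerqE mulmx_sumr summxE; apply: eq_bigr => k _.
by rewrite mulmx_rscale innerqE mxE.
Qed.

Lemma innerq_rscale v w x y :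
  innerq (rscale v x) (rscale w y) = conjq x * innerq v w * y.
Proof.
rewrite /innerq big_distrr big_distrl /=; apply: eq_bigr => k _.
by rewrite !mxE conjqM !mulrA.
Qed.

Lemma innerq_self v : innerq v v = realq (\sum_k normsq (v k 0)).
Proof.
rewrite (big_morph realq realqD (erefl 0)).
by apply: eq_bigr => k _; rewrite mul_conjq.
Qed.

Lemma innerq_self_eq0 v : (innerq v v == 0) = (v == 0).
Proof.
rewrite innerq_self; apply/eqP/eqP => [[]|->].
  move/eqP; rewrite psumr_eq0 => [/allP h|k _]; last exact: normsq_ge0.
  apply/colP => k; have /= := h k (mem_index_enum k).
  by rewrite normsq_eq0 mxE => /eqP.
rewrite big1 // => k _; rewrite mxE; apply/eqP.
by rewrite normsq_eq0.
Qed.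

(* Expanding |A^* v - v conj(lam)|^2, all four terms equal |v|^2 |lam|^2,
   because v^* v is real and hence central. *)
Lemma normal_adjoint_eigen (A : 'M[H]_N) v lam :
  is_normal A -> A *m v = rscale v lam ->
  adjmx A *m v = rscale v (conjq lam).
Proof.
move=> nA; rewrite !rscaleE => Av; apply/eqP; rewrite -subr_eq0.
rewrite -innerq_self_eq0 innerq_eq0 adjmxB !adjmxM adjmxK adjmx_scalar conjqK.
set L := (lam%:M : 'M_1); set L' := ((conjq lam)%:M : 'M_1).
have vA : adjmx v *m adjmx A = L' *m adjmx v.
  by rewrite -adjmxM Av adjmxM adjmx_scalar.
pose n := adjmx v *m v.
have nE : n = (realq (\sum_k normsq (v k 0)))%:M.
  by rewrite -innerq_self innerqE [LHS]mx11_scalar.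
have nC x : n *m (x%:M) = x%:M *m n by rewrite nE -!scalar_mxM realq_comm.
have nL : n *m L = L *m n := nC _; have nL' : n *m L' = L' *m n := nC _.
have LC : L *m L' = L' *m L by rewrite -!scalar_mxM mulq_conj.
rewrite mulmxBl !mulmxBr.
(* This is the term where normality enters, exchanging [A *m adjmx A] for [adjmx A *m A]. *)
have -> : adjmx v *m A *m (adjmx A *m v) = n *m (L' *m L).
  by rewrite !mulmxA nL' -(mulmxA _ A) nA !mulmxA vA -!mulmxA Av.
have -> : adjmx v *m A *m (v *m L') = n *m (L' *m L).
  by rewrite -LC -mulmxA (mulmxA A) Av !mulmxA.
have -> : L *m adjmx v *m (adjmx A *m v) = n *m (L' *m L).
  by rewrite -LC [RHS]mulmxA nL -[RHS]mulmxA nL' mulmxA -(mulmxA L) vA -!mulmxA.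
have -> : L *m adjmx v *m (v *m L') = n *m (L' *m L).
  by rewrite -LC [RHS]mulmxA nL /n !mulmxA.
by rewrite subrr.
Qed.

End Columns.

(** Each quaternionic equation amounts to four real ones. The matrix [S] stacks the four coordinate
    matrices of [M]; having 4m < n rows, it has a nonzero real kernel. *)
Lemma real_dependence m n (M : 'M[H]_(m, n)) : (m * 4 < n)%N ->
  exists2 c : 'cV[R]_n, c != 0 & M *m map_mx realq c = 0.
Proof.
move=> ltmn.
pose S := col_mx (col_mx (map_mx (@qre R) M) (map_mx (@qi R) M))
                 (col_mx (map_mx (@qj R) M) (map_mx (@qk R) M)).
have : kermx S^T != 0.
  rewrite kermx_eq0 /row_free neq_ltn (leq_ltn_trans (rank_leq_col _)) //.
  by apply: leq_ltn_trans ltmn; rewrite !mulnS muln0 addn0 !addnA.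
case/rowV0Pn => r /sub_kermxP rS r0.
exists r^T; first by rewrite -trmx0 (inj_eq trmx_inj).
have : S *m r^T = 0 by rewrite -[S]trmxK -trmx_mul rS trmx0.
rewrite !mul_col_mx -!col_mx0 => /eq_col_mx[] /eq_col_mx[e1 e2] /eq_col_mx[e3 e4].
have comp (f : H -> R) (i : 'I_m) : {morph f : x y / x + y} -> f 0 = 0 ->
    (forall x r, f (x * realq r) = f x * r) -> map_mx f M *m r^T = 0 ->
    f ((M *m map_mx realq r^T) i 0) = 0.
  move=> fD f0 fM /colP/(_ i); rewrite !mxE => <-.
  by rewrite (big_morph f fD f0); apply: eq_bigr => j _; rewrite !mxE fM.
have compM x s : x * realq s = Quat (qre x * s) (qi x * s) (qj x * s) (qk x * s).
  by rewrite quatM /=; congr Quat; ring.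
have quat_eta (x : H) : x = Quat (qre x) (qi x) (qj x) (qk x) by case: x.
apply/colP => i; rewrite [RHS]mxE [LHS]quat_eta !comp // => *; by rewrite compM.
Qed.

(** A quaternionic column of length n is [E] times a real one of length 4n, where [E] consists of
    the blocks 1, i, j, k times the identity. A real dependence among the columns of [F *m E] exists
    because 4m < 4n. *)
Lemma wide_kernel m n (F : 'M[H]_(m, n)) : (m < n)%N ->
  exists2 u : 'cV[H]_n, u != 0 & F *m u = 0.
Proof.
move=> ltmn.
pose U (x : H) : 'M[H]_n := x%:M.
pose E := row_mx (row_mx (U (Quat 1 0 0 0)) (U (Quat 0 1 0 0)))
                 (row_mx (U (Quat 0 0 1 0)) (U (Quat 0 0 0 1))).
have lt4 : (m * 4 < n + n + (n + n))%N by rewrite !addnn -!muln2 -mulnA ltn_pmul2r.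
have [c c0 FEc] := real_dependence (F *m E) lt4.
exists (E *m map_mx realq c); last by rewrite mulmxA.
(* The four blocks of [c] are the real coordinates of [E *m map_mx realq c], so they vanish with
   it. *)
apply: contraNneq c0; rewrite -[c]vsubmxK -[usubmx c]vsubmxK -[dsubmx c]vsubmxK.
move: (usubmx (usubmx c)) (dsubmx (usubmx c)) (usubmx (dsubmx c)) (dsubmx (dsubmx c)).
move=> c1 c2 c3 c4; rewrite !map_col_mx !mul_row_col !mul_scalar_mx => /colP e.
have {}e i : Quat (c1 i 0) (c2 i 0) (c3 i 0) (c4 i 0) = 0.
  have := e i; rewrite [RHS]mxE => <-; rewrite !mxE !quatM !quatD /=; congr Quat; ring.
suff [-> -> -> ->] : [/\ c1 = 0, c2 = 0, c3 = 0 & c4 = 0] by rewrite !col_mx0.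
by split; apply/colP => i; have [] := e i; rewrite mxE.
Qed.

(** * Orthogonal families and bases *)

Section OrthogonalFamilies.
Variable N : nat.
Implicit Types u v w : 'cV[H]_N.

Lemma orthogonal_family_free n (f : 'I_n -> 'cV[H]_N) :
  orthogonal_family f -> (forall k, f k != 0) -> right_free f.
Proof.
move=> fo f0 c e j; apply/eqP.
have := congr1 (innerq (f j)) e; rewrite innerq_sumr (bigD1 j) //= big1 ?addr0.
  move=> h; have : innerq (f j) (f j) * c j == 0.
    by rewrite h /innerq big1 // => k _; rewrite mxE mulr0.
  by rewrite quat_mulf_eq0 innerq_self_eq0 (negPf (f0 j)).
by move=> k kj; rewrite fo ?mul0r // eq_sym.
Qed.

Lemma mulmx_cols n (f : 'I_n -> 'cV[H]_N) (c : 'cV[H]_n) :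
  (\matrix_(i, k) f k i 0) *m c = \sum_k rscale (f k) (c k 0).
Proof.
by apply/colP => i; rewrite !mxE summxE; apply: eq_bigr => k _; rewrite !mxE.
Qed.

(** The N + 1 columns [f k] and [v] satisfy a nontrivial relation. The coefficient [e] of [v] is
    nonzero, since otherwise freeness would kill the whole relation; dividing by [e] on the right
    expresses [v] through [f]. *)
Lemma right_free_basis (f : 'I_N -> 'cV[H]_N) : right_free f -> right_basis f.
Proof.
move=> ff; split=> // v.
have [|u u0] := wide_kernel (row_mx (\matrix_(i, k) f k i 0) v).
  by rewrite addn1.
rewrite -[u]vsubmxK mul_row_col mulmx_cols [dsubmx u]mx11_scalar -rscaleE.
set e := dsubmx u 0 0 => h.
have e0 : e != 0.
  apply: contraNneq u0 => e0.
  have z : rscale v e = 0 by apply/eqP; rewrite rscale_eq0 e0 eqxx orbT.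
  rewrite z addr0 in h.
  rewrite -[u]vsubmxK [dsubmx u]mx11_scalar -/e e0.
  have -> : usubmx u = 0.
    by apply/colP => k; rewrite (ff _ h k) mxE.
  by rewrite raddf0 col_mx0.
exists (fun k => - (usubmx u k 0) / e).
have -> : v = rscale (rscale v e) e^-1.
  by rewrite rscaleA divrr ?quat_unitE //; apply/colP => i; rewrite mxE mulr1.
have -> : rscale v e = - \sum_k rscale (f k) (usubmx u k 0).
  by apply/eqP; rewrite -addr_eq0 addrC h.
apply/colP => i; rewrite !mxE !summxE -sumrN big_distrl; apply: eq_bigr => k _.
by rewrite !mxE /= -mulrN mulrA.
Qed.

End OrthogonalFamilies.

End QuaternionMatrices.

(** * Annihilating polynomials and eigenvectors in a stable kernel *)

Section Krylov.
Variables (R : rcfType) (N : nat) (A : 'M[quat R]_N).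
Local Notation H := (quat R).
Implicit Types (u v : 'cV[H]_N) (p q : {poly R[i]}).

Definition complexq (z : R[i]) : H := Quat (complex.Re z) (complex.Im z) 0 0.

Lemma complexqM : {morph complexq : z w / z * w}.
Proof.
by move=> [a b] [c d]; rewrite quatM /complexq /=; congr Quat; ring.
Qed.

Lemma complexqB : {morph complexq : z w / z - w}.
Proof. by move=> [a b] [c d]; rewrite quatN quatD /complexq /= oppr0 addr0. Qed.

Definition krylov u k : 'cV[H]_N := iter k (mulmx A) u.

(* p acts as sum_k A^k u p_k: the complex coefficients stand on the right, where
   they commute with A and with one another. *)
Definition poly_act p u := \sum_(k < size p) rscale (krylov u k) (complexq p`_k).

Lemma poly_act_widen p u n : (size p <= n)%N ->
  poly_act p u = \sum_(k < n) rscale (krylov u k) (complexq p`_k).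
Proof.
move=> pn; rewrite /poly_act.
rewrite (big_ord_widen n (fun k => rscale (krylov u k) (complexq p`_k))) //.
rewrite big_mkcond; apply: eq_bigr => k _; case: ltnP => // hk.
by rewrite nth_default //; apply/esym/eqP; rewrite rscale_eq0 eqxx orbT.
Qed.

(** Multiplication by 'X shifts the coefficients by one, which applies [A] since right scalars
    commute with [A]; multiplication by [c] scales on the right. *)
Lemma poly_act_mulXsub q c u :
  poly_act (q * ('X - c%:P)) u =
  A *m poly_act q u - rscale (poly_act q u) (complexq c).
Proof.
rewrite (@poly_act_widen _ _ (size q).+1); last first.
  by rewrite (leq_trans (size_polyMleq _ _)) // size_XsubC addn2.
have -> : A *m poly_act q u =
    \sum_(k < (size q).+1) rscale (krylov u k) (complexq (q * 'X)`_k).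
  rewrite big_ord_recl coefMX /= mulmx_sumr.
  have -> : rscale u (complexq 0) = 0 by apply/eqP; rewrite rscale_eq0 eqxx orbT.
  rewrite add0r; apply: eq_bigr => k _.
  by rewrite mulmx_rscale coefMX.
rewrite (@poly_act_widen q u (size q).+1) // rscaleE mulmx_suml -sumrB.
apply: eq_bigr => k _; rewrite -rscaleE rscaleA -complexqM -coefMC mulrBr coefB.
by rewrite complexqB; apply/colP => i; rewrite !mxE mulrBr.
Qed.

(** A dependence over the quaternions could have coefficients outside R[i]. Taking 4N + 1 vectors
    gives real coefficients, which are then read in R[i]. *)
Lemma krylov_annihilator u :
  exists2 p : {poly R[i]}, p != 0 & poly_act p u = 0.
Proof.
pose K := \matrix_(i < N, k < (N * 4).+1) krylov u k i 0.
have [c c0 Kc] := real_dependence K (ltnSn _).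
pose p := rVpoly (map_mx (real_complex R) c^T); exists p.
  apply: contraNneq c0 => p0; apply/eqP/colP => k.
  have := coef_rVpoly_ord (map_mx (real_complex R) c^T) k.
  by rewrite -/p p0 coef0 !mxE => -[].
rewrite (@poly_act_widen _ _ (N * 4).+1) ?size_poly //.
rewrite -[RHS]Kc mulmx_cols; apply: eq_bigr => k _.
by rewrite coef_rVpoly_ord !mxE.
Qed.

Variables (m : nat) (F : 'M[H]_(m, N)) (G : 'M[H]_m).
(** This intertwining makes the kernel of [F] stable under [A]. *)
Hypothesis FA : F *m A = G *m F.

Lemma krylov_kernel u k : F *m u = 0 -> F *m krylov u k = 0.
Proof.
by move=> Fu; elim: k => //= k IHk; rewrite mulmxA FA -mulmxA IHk mulmx0.
Qed.

Lemma poly_act_kernel p u : F *m u = 0 -> F *m poly_act p u = 0.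
Proof.
move=> Fu; rewrite mulmx_sumr big1 // => k _; rewrite mulmx_rscale.
by rewrite krylov_kernel // rscaleE mul0mx.
Qed.

(** Induction on the size of a polynomial [p] killing [u]: a root [c] gives p = q (X - c). Either
    [q] already kills [u], or [poly_act q u] is an eigenvector for [c]. *)
Lemma eigenvector_in_kernel : (m < N)%N ->
  exists lam v, [/\ v != 0, F *m v = 0 & A *m v = rscale v lam].
Proof.
move=> /(wide_kernel F) [u u0 Fu].
have [p] := krylov_annihilator u.
have [n] := ubnP (size p); elim: n p => // n IHn p lepn p0 pu.
(* A nonzero constant cannot kill [u]; any other [p] has a root in R[i]. *)
have [sp1|sp1] := eqVneq (size p) 1.
  move: pu; rewrite /poly_act sp1 big_ord1 /= => /eqP; rewrite rscale_eq0.
  rewrite (negPf u0) /= /complexq quat0 => /eqP [re im].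
  have : p`_0 == 0 by rewrite eq_complex /= re im !eqxx.
  by move: p0; rewrite -lead_coef_eq0 lead_coefE sp1 /= => /negPf->.
have /closed_rootP [c /factor_theorem [q qp]] := sp1.
have q0 : q != 0 by apply: contraNneq p0 => q0; rewrite qp q0 mul0r.
have [qu|qu] := eqVneq (poly_act q u) 0.
  apply: (IHn q) => //; move: lepn.
  by rewrite qp size_Mmonic ?monicXsubC // size_XsubC addn2.
exists (complexq c), (poly_act q u); split=> //; first exact: poly_act_kernel.
by apply/eqP; rewrite -subr_eq0 -poly_act_mulXsub -qp pu.
Qed.

End Krylov.

(** * Orthogonal eigenvectors of a normal matrix *)

Section NormalMatrices.
Variables (R : rcfType) (N : nat) (A : 'M[quat R]_N).
Local Notation H := (quat R).
Hypothesis nA : is_normal A.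

Lemma orthogonal_eigenvectors m : (m <= N)%N ->
  exists (f : 'I_m -> 'cV[H]_N) (lam : 'I_m -> H),
  [/\ forall k, f k != 0, forall k, A *m f k = rscale (f k) (lam k)
    & orthogonal_family f].
Proof.
elim: m => [|m IHm] ltmN.
  exists (fun _ => 0), (fun _ => 0).
  by split; [case | case | case].
have [f [lam [f0 fA fo]]] := IHm (ltnW ltmN).
(* The kernel of [F] is the orthogonal complement of the [f i]. Its stability follows from f_i^* A =
   (A^* f_i)^* = lam_i f_i^*. *)
pose F := \matrix_(i < m, j < N) adjmx (f i) 0 j.
pose G : 'M[H]_m := diag_mx (\row_i lam i).
have rowF i : row i F = adjmx (f i) by apply/rowP => j; rewrite !mxE.
have FA : F *m A = G *m F.
  apply/row_matrixP => i; rewrite row_mul rowF -[A]adjmxK -adjmxM.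
  rewrite (normal_adjoint_eigen nA (fA i)) /G mul_diag_mx.
  by apply/rowP => j; rewrite !mxE conjqM conjqK.
have [l [v [v0 Fv Av]]] := eigenvector_in_kernel FA ltmN.
have fv i : innerq (f i) v = 0.
  by apply/eqP; rewrite innerq_eq0 -rowF -row_mul Fv row0.
(* [ext] appends [t] to the family [g] at the last index. *)
pose ext T (g : 'I_m -> T) t (k : 'I_m.+1) := oapp g t (unlift ord_max k).
exists (ext _ f v), (ext _ lam l); split=> [k|k|i j]; rewrite /ext.
- by case: unliftP => [k' _|_] /=.
- by case: unliftP => [k' _|_] /=.
case: unliftP => [i' ->|->]; case: unliftP => [j' ->|->] //=.
- by rewrite (inj_eq lift_inj) => /fo.
- by rewrite -innerq_conj fv conjq0.
- by rewrite eqxx.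
Qed.

End NormalMatrices.

(** * Eigenvectors of the difference operator as initial value solutions *)

Section DifferenceOperator.
Variables (R : realFieldType) (N : nat) (a b : nat -> quat R) (h1 h2 : quat R).
Local Notation H := (quat R).

Lemma bvp_solution_eigen (lam : H) (v : 'cV[H]_N) :
  bvp_solution a b h1 h2 lam v <-> diff_mx N a b h1 h2 *m v = rscale v lam.
Proof.
rewrite -diff_opE; split=> [sol|/colP e [//|k] /= kN].
  by apply/colP => i; rewrite !mxE (sol i.+1) ?bc_extend_val //= ltn_ord.
by have := e (Ordinal kN); rewrite !mxE -(bc_extend_val h1 h2).
Qed.

(** A zero start propagates through the recurrence; hence an eigenvector cannot have first entry
    zero. *)
Lemma varphi0 (lam : H) : varphi N a b h1 lam 0 = 0.
Proof.
apply/colP => i; rewrite !mxE /phi.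
suff -> : phi_pair a b h1 lam 0 i.+1 = (0, 0) by [].
by elim: i.+1 => [|k /= ->]; rewrite /= ?mul0r ?mulr0 ?subr0 ?mulr0 ?oppr0.
Qed.

Hypothesis hb : forall k, (k <= N)%N -> b k != 0.

(** The recurrence and the left boundary condition determine x from x(1), which is the entry of [v]
    at index 0. *)
Lemma bvp_solution_varphi (hN : (0 < N)%N) (lam : H) (v : 'cV[H]_N) :
  bvp_solution a b h1 h2 lam v ->
  v = varphi N a b h1 lam (v (Ordinal hN) 0).
Proof.
case/(bvp_solutionP _ _ _ _ _ _ hN) => x [xv x0 _ xE].
have /(phi_unique_solution _ _ _ _ _ hb) xphi :
  [/\ diff_eqn N a b lam x, left_bc h1 x & x 1%N = v (Ordinal hN) 0].
  by split=> //; rewrite -xv.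
by apply/colP => i; rewrite mxE -xv xphi // ltnW // ltnS.
Qed.

End DifferenceOperator.

Theorem theorem3p5 (R : realType) (N : nat) (a b : nat -> quat R)
    (h1 h2 : quat R)
    (hN : (0 < N)%N)
    (hb : forall k, (k <= N)%N -> b k != 0)
    (hL : is_normal (diff_mx N a b h1 h2)) :
  forall s : quat R, s != 0 ->
  exists lam : 'I_N -> quat R,
    [/\ injective lam,
        orthogonal_basis (fun k => varphi N a b h1 (lam k) s),
        forall k, bvp_solution a b h1 h2 (lam k) (varphi N a b h1 (lam k) s)
      & forall k, right_eigenvalue (diff_mx N a b h1 h2) (lam k)].
Proof.
move=> s s0.
have [f [mu [f0 fA fo]]] := orthogonal_eigenvectors hL (leqnn N).
pose q k := (f k (Ordinal hN) 0)^-1 * s.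
have first0 k : f k (Ordinal hN) 0 != 0.
  apply: contraNneq (f0 k) => fk0.
  have /bvp_solution_eigen/(bvp_solution_varphi hb hN) -> := fA k.
  by rewrite fk0 varphi0.
have q0 k : q k != 0.
  by rewrite quat_mulf_eq0 negb_or s0 andbT -quat_unitE unitrV quat_unitE.
(* Forced by f mu q = (f q) (q^-1 mu q). *)
pose lam k := (q k)^-1 * mu k * q k.
have gA k : diff_mx N a b h1 h2 *m rscale (f k) (q k) =
            rscale (rscale (f k) (q k)) (lam k).
  by rewrite mulmx_rscale fA !rscaleA /lam !mulrA divrr ?quat_unitE // mul1r.
have gE k : varphi N a b h1 (lam k) s = rscale (f k) (q k).
  have /bvp_solution_eigen/(bvp_solution_varphi hb hN) -> := gA k.
  by congr varphi; rewrite mxE /q mulVKr ?quat_unitE.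
have v0 k : varphi N a b h1 (lam k) s != 0.
  by rewrite gE rscale_eq0 negb_or f0 q0.
have vo : orthogonal_family (fun k => varphi N a b h1 (lam k) s).
  by move=> i j ij; rewrite !gE innerq_rscale fo // mulr0 mul0r.
exists lam; split.
(* For i != j with equal eigenvalues, one nonzero vector would be orthogonal to itself. *)
- move=> i j lij; apply: contraTeq (v0 i) => /vo; rewrite lij => /eqP.
  by rewrite innerq_self_eq0 negbK.
- by split=> //; apply: right_free_basis; apply: orthogonal_family_free.
- by move=> k; apply/bvp_solution_eigen; rewrite gE.
- by move=> k; exists (varphi N a b h1 (lam k) s); rewrite ?gE // -gE.
Qed.
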